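(* Let $a,b$ be positive integers and let $G$ be a tied down $[a,b]$-graph (with the standard tie-down at any vertex $i$). Then, in $\mathbb{R}[\mathbf{x}]$, $$P_G=\sum_{\mathcal T}\pm\{\mathcal T\},$$ where the sum runs over all tree decompositions $\mathcal T$ of $G$, $\{\mathcal T\}$ is the tree decomposition monomial of $\mathcal T$, and each sign is a suitable element of $\{+1,-1\}$ depending on $\mathcal T$ (determined by the definition of the determinant).
   Context: Let $k=a+b$. A bi-colored graph is a finite multigraph $G=(V,E=R\sqcup B)$ on $V=[n]=\{1,\dots,n\}$ with red edges $R$ and black edges $B$; fix an ordering of $E$. A multigraph is $(k,\ell)$-sparse if every nonempty subset of $n'$ vertices spans at most $kn'-\ell$ edges. $G$ is $[a,b]$-sparse if there is $B'\subseteq B$ with $(V,R\cup B')$ $(a,a)$-sparse and $(V,B\setminus B')$ $(b,b)$-sparse; it is an $[a,b]$-graph if in addition it has exactly $kn-k$ edges. For each edge $e$ let $\mathbf{x}(e)=(\mathbf{x}(e)_1,\dots,\mathbf{x}(e)_k)$ be a vector whose entries are distinct formal indeterminates, except that the last $b$ entries are $0$ if $e$ is red. $\mathbb{R}[\mathbf{x}]$ is the polynomial ring in all these indeterminates. The generic rigidity matrix $M(G(\mathbf{x}))$ has $k$ columns for each vertex and one row for each edge, in the order of the edges: the row of an edge $e$ with endpoints $i<j$ has $\mathbf{x}(e)$ in the columns of $i$, $-\mathbf{x}(e)$ in the columns of $j$, and zeros elsewhere. The standard tie-down at vertex $i$ appends at the bottom a $k\times kn$ matrix whose only nonzero entries form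 the identity matrix in the $k$ columns of vertex $i$; the result is $M_T(G(\mathbf{x}))$. The pure condition is $P_G=\det M_T(G(\mathbf{x}))$. A tree decomposition $\mathcal T=(A_1,\dots,A_a,T_1,\dots,T_b)$ of $G$ is an (ordered) partition of $E$ into $k$ edge sets, each a spanning tree of $V$, such that all red edges lie in the sets $A_i$. Its tree decomposition monomial is $$\{\mathcal T\}=\prod_{i=1}^{a}\ \prod_{e\in A_i}\mathbf{x}(e)_i\ \cdot\ \prod_{j=1}^{b}\ \prod_{e\in T_j}\mathbf{x}(e)_{a+j}.$$ *)

(* Defs.v *)
From mathcomp Require Import all_boot all_order all_algebra.
From mathcomp Require Import boolp reals.
From mathcomp Require Import mpoly.

Set Implicit Arguments.
Unset Strict Implicit.
Unset Printing Implicit Defensive.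

Import GRing.Theory.
Local Open Scope ring_scope.

(* The edges are indexed by 'I_m, whose order is the fixed ordering of E; the
   black edges are the complement of the red ones. Loops are allowed here, but
   no [a,b]-sparse graph has one (take a single vertex in the sparsity count). *)
Record bigraph (n m : nat) := Bigraph {
  src : 'I_m -> 'I_n;
  tgt : 'I_m -> 'I_n;
  red : {set 'I_m};
  src_le_tgt : forall e, (src e <= tgt e)%N
}.

Section Combinatorics.
Variables (n m : nat) (G : bigraph n m).
Implicit Types (F : {set 'I_m}) (S : {set 'I_n}).

Definition black : {set 'I_m} := ~: red G.

Definition spanned F S : {set 'I_m} :=
  [set e in F | (src G e \in S) && (tgt G e \in S)].

(* l is moved to the left-hand side to avoid truncated subtraction. *)
Definition sparse (k l : nat) F : Prop :=
  forall S, S != set0 -> (#|spanned F S| + l <= k * #|S|)%N.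

Definition ab_sparse (a b : nat) : Prop :=
  exists B' : {set 'I_m}, [/\ B' \subset black,
    sparse a a (red G :|: B') & sparse b b (black :\: B')].

(* The second conjunct says that there are exactly k n - k edges, k = a + b. *)
Definition ab_graph (a b : nat) : Prop :=
  ab_sparse a b /\ (m + (a + b) = n * (a + b))%N.

Definition joins (e : 'I_m) (u v : 'I_n) : bool :=
  ((src G e == u) && (tgt G e == v)) || ((src G e == v) && (tgt G e == u)).

Definition adj F : rel 'I_n := [rel u v | [exists e in F, joins e u v]].

Definition connected_graph F : Prop := forall u v, connect (adj F) u v.

(* A cycle v_1 e_1 v_2 e_2 ... v_p e_p (back to v_1) is encoded as the sequence
   of the pairs (v_i, e_i); loops (p = 1) and double edges (p = 2) count. *)
Definition graph_cycle F (p : seq ('I_n * 'I_m)) : Prop :=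
  [/\ p != [::], {subset unzip2 p <= F}, uniq (unzip1 p), uniq (unzip2 p)
    & cycle (fun x y => joins x.2 x.1 y.1) p].

Definition spanning_tree F : Prop :=
  connected_graph F /\ (forall p, ~ graph_cycle F p).

(* The tuple (A_1, ..., A_a, T_1, ..., T_b) is a function T on 'I_(a + b), with
   A_i = T (lshift b i) and T_j = T (rshift a j). The parts may be empty, as
   the spanning trees are when n = 1. *)
Definition tree_decomposition (a b : nat)
    (T : {ffun 'I_(a + b) -> {set 'I_m}}) : Prop :=
  [/\ (forall c d, c != d -> [disjoint T c & T d]),
      \bigcup_c T c = [set: 'I_m],
      (forall c, spanning_tree (T c))
    & red G \subset \bigcup_(i < a) T (lshift b i)].

End Combinatorics.

Section Rigidity.
Variables (R : realType) (a b n m : nat) (G : bigraph n m).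

(* The index set of the indeterminates: (e, c) stands for the entry x(e)_c. *)
Definition indet : finType :=
  {p : 'I_m * 'I_(a + b) | (p.1 \in red G) ==> (p.2 < a)%N}.

Definition xring := {mpoly R[#|indet|]}.

Definition x (e : 'I_m) (c : 'I_(a + b)) : xring :=
  if insub (e, c) is Some v then 'X_(enum_rank (v : indet)) else 0.

(* mxvec lists the entries of an n x (a + b) matrix row by row, so the a + b
   columns belonging to vertex v are consecutive. *)
Definition rigidity_mx : 'M[xring]_(m, n * (a + b)) :=
  \matrix_(e < m) mxvec (\matrix_(v < n, c < a + b)
    (x e c *+ (v == src G e) - x e c *+ (v == tgt G e))).

Definition tie_down_mx (i : 'I_n) : 'M[xring]_(a + b, n * (a + b)) :=
  \matrix_(c < a + b) mxvec (delta_mx i c).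

Definition tied_rigidity_mx (i : 'I_n) : 'M[xring]_(m + (a + b), n * (a + b)) :=
  col_mx rigidity_mx (tie_down_mx i).

(* The cast makes the type square. *)
Definition pure_condition (i : 'I_n)
    (mE : (m + (a + b) = n * (a + b))%N) : xring :=
  \det (castmx (mE, erefl (n * (a + b))%N) (tied_rigidity_mx i)).

Definition tree_monomial (T : {ffun 'I_(a + b) -> {set 'I_m}}) : xring :=
  (\prod_(i < a) \prod_(e in T (lshift b i)) x e (lshift b i)) *
  (\prod_(j < b) \prod_(e in T (rshift a j)) x e (rshift a j)).

End Rigidity.

(* Main.v *)
(* Every row of the rigidity matrix is a sum over c of x(e)_c times the signed
   incidence vector of e in the c-th copy of V.  Multilinearity of the
   determinant thus writes P_G as a sum over the colourings f of the edges, the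
   coefficient of prod_e x(e)_{f(e)} being the determinant D_f of an integer
   matrix.  If all colour classes are connected, the tie-down rows and the
   incidence rows generate every basis vector over the integers, so D_f is a
   unit.  If a class is disconnected, the indicator of the vertices that it does
   not join to the tied one gives a vector of the right kernel; if a class
   contains a cycle, its edges, signed by orientation, give a vector of the left
   kernel; in both cases D_f = 0. *)
Require Import Defs.
From mathcomp Require Import all_boot all_order all_algebra.
From mathcomp Require Import boolp reals.
From mathcomp Require Import mpoly.

Set Implicit Arguments.
Unset Strict Implicit.
Unset Printing Implicit Defensive.

Import GRing.Theory.
Local Open Scope ring_scope.

(** * Determinants of matrices that are square only up to a cast *)

Section CastDeterminant.
Variables (S : comNzRingType) (p N : nat) (eq_pN : p = N).

(** Both dimensions are variables so that the equation between them can be destructed and the cast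
    disappears; [m + k = n * k] itself does not allow this. *)
Lemma det_castmx_unit (X : 'M[S]_(N, p)) (A : 'M[S]_(p, N)) :
  X *m A = 1%:M -> exists d, d * \det (castmx (eq_pN, erefl N) A) = 1.
Proof.
case: N / eq_pN X A => X A XA1; exists (\det X).
by rewrite castmx_id -det_mulmx XA1 det1.
Qed.

End CastDeterminant.

Section CastDeterminantDomain.
Variables (S : idomainType) (p N : nat) (eq_pN : p = N).

Lemma det_castmx_right_kernel (A : 'M[S]_(p, N)) (u : 'cV_N) :
  A *m u = 0 -> \det (castmx (eq_pN, erefl N) A) != 0 -> u = 0.
Proof.
case: N / eq_pN A u => A u Au0; rewrite castmx_id => detA_neq0.
have /eqP : \det A *: u = 0 by rewrite -mul_scalar_mx -mul_adj_mx -mulmxA Au0 mulmx0.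
by rewrite scalemx_eq0 (negPf detA_neq0) => /eqP.
Qed.

Lemma det_castmx_left_kernel (A : 'M[S]_(p, N)) (w : 'rV_p) :
  w *m A = 0 -> \det (castmx (eq_pN, erefl N) A) != 0 -> w = 0.
Proof.
case: N / eq_pN A => A wA0; rewrite castmx_id => detA_neq0.
have /eqP : \det A *: w = 0 by rewrite -mul_mx_scalar -mul_mx_adj mulmxA wA0 mul0mx.
by rewrite scalemx_eq0 (negPf detA_neq0) => /eqP.
Qed.

End CastDeterminantDomain.

(** In the Leibniz formula it is enough to compare the terms of one permutation: there the product
    over the top rows distributes into a sum over choice functions [f], and the bottom rows give a
    common factor. *)
Lemma det_col_mx_multilinear (S : comNzRingType) (k m t N : nat)
    (eq_mtN : (m + t = N)%N) (y : 'I_m -> 'I_k -> S)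
    (B : 'I_m -> 'I_k -> 'rV[S]_N) (C : 'M[S]_(t, N)) :
  \det (castmx (eq_mtN, erefl N) (col_mx (\matrix_e \sum_c y e c *: B e c) C)) =
  \sum_(f : {ffun 'I_m -> 'I_k}) (\prod_e y e (f e)) *
    \det (castmx (eq_mtN, erefl N) (col_mx (\matrix_e B e (f e)) C)).
Proof.
case: N / eq_mtN B C => B C; rewrite castmx_id.
under [RHS]eq_bigr => f _ do rewrite castmx_id mulr_sumr.
rewrite [RHS]exchange_big; apply: eq_bigr => s _ /=.
rewrite big_split_ord /=.
under eq_bigr => e _.
  rewrite col_mxEu mxE summxE; under eq_bigr => c _ do rewrite mxE; over.
rewrite bigA_distr_bigA mulr_suml mulr_sumr; apply: eq_bigr => f _.
rewrite big_split_ord /= big_split /= -mulrA mulrCA; do 3! congr (_ * _).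
  by apply: eq_bigr => e _; rewrite col_mxEu mxE.
by apply: eq_bigr => c _; rewrite !col_mxEd.
Qed.

(** * Integer incidence determinants of edge colourings *)

Section ColouredIncidence.
Variables (n m k : nat) (G : bigraph n m) (i : 'I_n).
Implicit Type f : {ffun 'I_m -> 'I_k}.

Definition vertex_row (v : 'I_n) (c : 'I_k) : 'rV[int]_(n * k) :=
  delta_mx 0 (mxvec_index v c).

Definition incidence_row (e : 'I_m) (c : 'I_k) : 'rV[int]_(n * k) :=
  vertex_row (src G e) c - vertex_row (tgt G e) c.

Lemma vertex_rowE u c v d :
  vertex_row u c 0 (mxvec_index v d) = ((v == u) && (d == c))%:R.
Proof. by rewrite /vertex_row -mxvec_delta mxvecE mxE. Qed.

Lemma incidence_rowE e c v d :
  incidence_row e c 0 (mxvec_index v d) =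
    (d == c)%:R * ((v == src G e)%:R - (v == tgt G e)%:R).
Proof.
rewrite /incidence_row mxE vertex_rowE mxE vertex_rowE.
by case: (d == c); rewrite ?andbT ?andbF ?mul1r ?mul0r ?subrr.
Qed.

Definition tied_incidence_mx f : 'M[int]_(m + k, n * k) :=
  col_mx (\matrix_e incidence_row e (f e)) (\matrix_c vertex_row i c).

Definition colour_class f (c : 'I_k) : {set 'I_m} := [set e | f e == c].

Variable mE : (m + k = n * k)%N.

Definition incidence_det f : int :=
  \det (castmx (mE, erefl (n * k)%N) (tied_incidence_mx f)).

Lemma connected_incidence_det f :
  (forall c, connected_graph G (colour_class f c)) ->
  incidence_det f = 1 \/ incidence_det f = -1.
Proof.
move=> conn; set A := tied_incidence_mx f.
have span_edge e w : (exists z, z *m A = w) -> forall t,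
    exists z, z *m A = w + t *: incidence_row e (f e).
  move=> [z <-] t; exists (z + t *: delta_mx 0 (lshift k e)).
  by rewrite mulmxDl -scalemxAl -rowE rowKu rowK.
have span_vertex v c : exists z, z *m A = vertex_row v c.
  have /connectP[q] := conn c i v.
  (* Induction along a path from the tied vertex [i], whose basis vectors are tie-down rows; each
     further edge moves the endpoint by plus or minus its incidence row. *)
  elim/last_ind: q v => [|q u IHq] v; first move=> _ ->.
    by exists (delta_mx 0 (rshift m c)); rewrite -rowE rowKd rowK.
  rewrite rcons_path last_rcons => /andP[qP adj_u] ->.
  have [z zE] := IHq _ qP erefl.
  case/existsP: adj_u => e /andP[]; rewrite inE => /eqP fe_c.
  case/orP=> /andP[/eqP src_e /eqP tgt_e].
    have [z' z'E] := span_edge e _ (ex_intro _ z zE) (-1); exists z'.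
    by rewrite z'E scaleN1r /incidence_row fe_c src_e tgt_e opprB addrC subrK.
  have [z' z'E] := span_edge e _ (ex_intro _ z zE) 1; exists z'.
  by rewrite z'E scale1r /incidence_row fe_c src_e tgt_e addrC subrK.
(* The boolean equality lets [xchoose] pick the coefficient vectors, which become the rows of a left
   inverse. *)
have span_delta j : exists z : 'rV_(m + k), z *m A == delta_mx 0 j.
  by case/mxvec_indexP: j => v c; have [z zE] := span_vertex v c; exists z; apply/eqP.
have XA1 : (\matrix_j xchoose (span_delta j)) *m A = 1%:M.
  by apply/row_matrixP => j; rewrite row_mul rowK (eqP (xchooseP (span_delta j))) row1.
have [d dA] := det_castmx_unit mE XA1.
have: incidence_det f \is a GRing.unit by apply/unitrP; exists d; rewrite [_ * d]mulrC.
by rewrite qualifE /= => /orP[] /eqP ->; [left|right].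
Qed.

Lemma incidence_det_connected f c :
  incidence_det f != 0 -> connected_graph G (colour_class f c).
Proof.
move=> det_neq0.
have sym : connect_sym (adj G (colour_class f c)).
  apply: sym_connect_sym => u v; apply: eq_existsb => e.
  by rewrite /joins orbC.
suff reach v : connect (adj G (colour_class f c)) i v.
  by move=> u v; apply: connect_trans (reach v); rewrite sym.
pose F := adj G (colour_class f c).
pose u : 'cV[int]_(n * k) :=
  (mxvec (\matrix_(w < n, d < k) ((d == c) && ~~ connect F i w)%:R))^T.
have vertexM w d : vertex_row w d *m u = ((d == c) && ~~ connect F i w)%:R%:M.
  by rewrite -rowE; apply/rowP => j; rewrite !ord1 !mxE mxvecE mxE mulr1n.
have u0 : u = 0.
  (* Tie-down rows kill [u] since [i] reaches itself. Edge rows of colour [c] do since [i] reaches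
     both ends or neither; those of other colours miss the support of [u]. *)
  apply: det_castmx_right_kernel det_neq0; rewrite mul_col_mx -[RHS]vsubmxK.
  congr col_mx; apply/row_matrixP => e; rewrite row_mul rowK; last first.
    by rewrite vertexM connect0 andbF raddf0 linear0 row0.
  rewrite mulmxBl !vertexM linear0 row0.
  have [fe_c|] := eqVneq (f e) c; last by rewrite subrr.
  suff -> : connect F i (src G e) = connect F i (tgt G e) by rewrite subrr.
  apply: (same_connect_r sym); apply: connect1; apply/existsP; exists e.
  by rewrite inE fe_c /joins !eqxx.
have := vertexM v c; rewrite u0 mulmx0 eqxx /= => /matrixP/(_ 0 0).
by rewrite !mxE mulr1n; case: connect.
Qed.

Lemma incidence_det_acyclic f c p :
  incidence_det f != 0 -> ~ graph_cycle G (colour_class f c) p.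
Proof.
move=> det_neq0 [p_neq0 p_sub _ p_uniq p_cycle].
(* The sign is 1 when the cycle runs through the edge from [src] to [tgt], so that the signed rows
   telescope. *)
pose sg (y : 'I_n * 'I_m) : int := if src G y.2 == y.1 then 1 else -1.
have telescope y q : path (fun x y => joins G x.2 x.1 y.1) y q ->
    \sum_(z <- belast y q) sg z *: incidence_row z.2 c =
    vertex_row y.1 c - vertex_row (last y q).1 c.
  elim: q y => [|z q IHq] y /=; first by rewrite big_nil subrr.
  move=> /andP[yz /IHq]; rewrite big_cons => ->.
  rewrite -[RHS](subrKA (vertex_row z.1 c)); congr (_ + _).
  rewrite /sg /incidence_row; case/orP: yz => /andP[/eqP <- /eqP <-].
    by rewrite eqxx scale1r.
  (* If the test for [sg] succeeds here, the edge is a loop and its row is zero. *)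
  by case: eqP => [->|_]; rewrite ?subrr ?scaler0 // scaleN1r opprB.
pose w : 'rV[int]_(m + k) :=
  row_mx (\row_e \sum_(y <- p | y.2 == e) sg y) 0.
have w0 : w = 0.
  apply: det_castmx_left_kernel det_neq0.
  rewrite mul_row_col mul0mx addr0 mulmx_sum_row.
  under eq_bigr => e _ do rewrite rowK mxE scaler_suml.
  rewrite (exchange_big_dep predT) //=.
  transitivity (\sum_(y <- p) sg y *: incidence_row y.2 c).
    apply: eq_big_seq => y /(map_f snd)/p_sub; rewrite inE => /eqP <-.
    by rewrite (big_pred1 y.2).
  case: p p_cycle {p_neq0 p_sub p_uniq w} => [|y q] /=; first by rewrite big_nil.
  by move/telescope; rewrite belast_rcons last_rcons subrr.
(* The edges of the cycle are distinct, so the coefficient of its first edge in [w] is a single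
   sign, hence nonzero. *)
case: p p_neq0 p_uniq @w w0 {p_sub p_cycle} => // y q _ /= /andP[y_q _].
move=> /rowP/(_ (lshift k y.2)); rewrite row_mxEl !mxE big_cons eqxx.
rewrite big1_seq => [|z /andP[/eqP zy z_q]]; first by rewrite addr0 /sg; case: ifP.
by rewrite -zy map_f in y_q.
Qed.

Lemma incidence_det_spanning_tree f :
  incidence_det f != 0 -> forall c, spanning_tree G (colour_class f c).
Proof.
move=> det_neq0 c; split; first exact: incidence_det_connected.
by move=> p; apply: incidence_det_acyclic.
Qed.

End ColouredIncidence.

(** * Expansion of the pure condition, and colourings as tree decompositions *)

Section PureCondition.
Variables (R : realType) (a b n m : nat) (G : bigraph n m).
Let k := (a + b)%N.

Lemma rigidity_mx_incidence :
  rigidity_mx R a b G =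
    \matrix_e \sum_(c < k) x R G e c *: map_mx intr (incidence_row G e c).
Proof.
apply/matrixP => e j; case/mxvec_indexP: j => v d.
rewrite !mxE mxvecE mxE summxE (bigD1 d) //= big1 => [|c cd].
  rewrite mxE mxE incidence_rowE eqxx mul1r addr0 rmorphB /=.
  by rewrite mulrBr !rmorph_nat !mulr_natr.
by rewrite mxE mxE incidence_rowE eq_sym (negPf cd) mul0r mulr0.
Qed.

Lemma x_red e (c : 'I_k) : e \in red G -> (a <= c)%N -> x R G e c = 0.
Proof.
by move=> e_red ac; rewrite /x insubF //= e_red /= ltnNge ac.
Qed.

Lemma pure_condition_colourings i (mE : (m + k = n * k)%N) :
  pure_condition R G i mE =
  \sum_(f : {ffun 'I_m -> 'I_k})
    (\prod_e x R G e (f e)) * (incidence_det G i mE f)%:~R.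
Proof.
rewrite /pure_condition /tied_rigidity_mx rigidity_mx_incidence.
rewrite det_col_mx_multilinear; apply: eq_bigr => f _; congr (_ * _).
rewrite /incidence_det -det_map_mx map_castmx map_col_mx.
congr (\det (castmx _ (col_mx _ _))).
  by apply/row_matrixP => e; rewrite -map_row !rowK.
by apply/row_matrixP => c; rewrite -map_row !rowK mxvec_delta map_delta_mx.
Qed.

Definition classes_of (f : {ffun 'I_m -> 'I_k}) : {ffun 'I_k -> {set 'I_m}} :=
  [ffun c => colour_class f c].

Lemma tree_monomial_classes f :
  tree_monomial R G (classes_of f) = \prod_e x R G e (f e).
Proof.
rewrite /tree_monomial.
rewrite -(big_split_ord _ predT (fun c => \prod_(e in classes_of f c) x R G e c)).
rewrite [RHS](partition_big f predT) //=; apply: eq_bigr => c _.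
rewrite ffunE; apply: eq_big => [e|e]; first by rewrite inE.
by rewrite inE => /eqP ->.
Qed.

Lemma classes_of_tree_decomposition f :
  (forall c, spanning_tree G (colour_class f c)) ->
  (forall e, e \in red G -> (f e < a)%N) ->
  tree_decomposition G (classes_of f).
Proof.
move=> f_tree f_red; split=> [c d cd||c|].
- rewrite -setI_eq0; apply/eqP/setP => e; rewrite !ffunE !inE.
  by apply/negP => /andP[/eqP ->]; apply/negP.
- by apply/setP => e; rewrite inE; apply/bigcupP; exists (f e); rewrite // ffunE inE.
- by rewrite ffunE.
apply/subsetP => e /f_red fe_a; apply/bigcupP; exists (Ordinal fe_a) => //.
by rewrite ffunE inE; apply/eqP/val_inj.
Qed.

(** The default [c0] is taken only at edges lying in no [T c]; a tree decomposition has none. *)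
Definition colouring_of (c0 : 'I_k) (T : {ffun 'I_k -> {set 'I_m}}) :
  {ffun 'I_m -> 'I_k} := [ffun e => odflt c0 [pick c | e \in T c]].

Lemma classes_ofK c0 : cancel classes_of (colouring_of c0).
Proof.
move=> f; apply/ffunP => e; rewrite ffunE.
case: pickP => [c|/(_ (f e))]; rewrite ffunE inE ?eqxx //.
by move/eqP.
Qed.

Lemma colouring_ofK c0 T :
  tree_decomposition G T -> classes_of (colouring_of c0 T) = T.
Proof.
move=> [T_disj T_cover _ _]; apply/ffunP => c; apply/setP => e.
have uniqT d d' : e \in T d -> e \in T d' -> d = d'.
  by move=> ed ed'; apply/eqP/negP => /negP/T_disj/pred0P/(_ e) /=; rewrite ed ed'.
rewrite !ffunE inE ffunE; case: pickP => [d ed|noT] /=.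
  by apply/eqP/idP => [<- //|]; apply: uniqT.
by have := in_setT e; rewrite -T_cover => /bigcupP[d _]; rewrite noT.
Qed.

End PureCondition.

Theorem theorem3 (R : realType) (a b n m : nat) (G : bigraph n m)
    (a_gt0 : (0 < a)%N) (b_gt0 : (0 < b)%N) (hG : ab_graph G a b) (i : 'I_n) :
  exists s : {ffun 'I_(a + b) -> {set 'I_m}} -> bool,
    pure_condition R G i (proj2 hG) =
      \sum_(T : {ffun 'I_(a + b) -> {set 'I_m}}
             | `[< tree_decomposition G T >])
        (-1) ^+ s T * tree_monomial R G T.
Proof.
set mE := proj2 hG; pose c0 := lshift b (Ordinal a_gt0).
exists (fun T => incidence_det G i mE (colouring_of c0 T) == -1).
rewrite pure_condition_colourings (bigID (fun f => `[< tree_decomposition G (classes_of f) >])) /=.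
(* A colouring that gives no decomposition contributes 0: either some class is not a spanning tree
   and the determinant vanishes, or a red edge has one of the last [b] colours and its entry is
   0. *)
rewrite [X in _ + X]big1 ?addr0 => [|f /asboolP not_dec]; last first.
  have [->|det_neq0] := eqVneq (incidence_det G i mE f) 0; first by rewrite mulr0.
  have [f_red|] := altP (forall_inP (P := fun e => (f e < a)%N) (D := mem (red G))).
    by case: not_dec; apply: classes_of_tree_decomposition => //;
       apply: incidence_det_spanning_tree det_neq0.
  rewrite negb_forall_in => /exists_inP[e e_red]; rewrite -leqNgt => ae.
  by rewrite (bigD1 e) //= x_red // !mul0r.
(* The other colourings correspond bijectively to the tree decompositions. *)
rewrite [RHS](reindex_onto (@classes_of a b m) (colouring_of c0)) => [|T /asboolP]; last first.
  exact: colouring_ofK.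
apply: eq_big => [f|f /asboolP[_ _ trees _]]; first by rewrite classes_ofK eqxx andbT.
rewrite classes_ofK tree_monomial_classes mulrC; congr (_ * _).
have [|->|->] := @connected_incidence_det _ _ _ G i mE f.
- by move=> c; have [] := trees c; rewrite ffunE.
- by rewrite mulr1z.
- by rewrite eqxx expr1 mulrN1z.
Qed.
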